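(* Let $n\ge 2$ and let $h$ be a Hamiltonian cycle of $Q_n$ with chromatic vector $c(h)=(c_0,\ldots,c_{n-1})$. If $c_i>2^{n-2}$ for some $i$, then $h$ contains a square whose rims are $i$-th dimension edges; that is, there are two edges of $h$, both $i$-th dimension edges, which are opposite edges of a 4-cycle of $Q_n$.
   Context: $Q_n$ is the hypercube on $\{0,1\}^n$ (coordinates indexed $0,\ldots,n-1$), vertices adjacent iff they differ in exactly one coordinate; an $i$-th dimension edge is an edge whose endpoints differ in coordinate $i$. For a Hamiltonian cycle $h=h_0\cdots h_{2^n-1}$ (indices mod $2^n$), $c_i$ is the number of edges $\{h_\iota,h_{\iota+1}\}$ of $h$ that are $i$-th dimension edges. A 4-cycle $v_0v_1v_2v_3$ of $Q_n$ is a square inscribed in $h$ if there are indices $a,b$ with $h_ah_{a+1}h_bh_{b+1}=v_0v_1v_2v_3$ (straight square) or $=v_0v_1v_3v_2$ (twisted square); its rims are the edges $\{v_0,v_1\}$ and $\{v_2,v_3\}$. *)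

(* Defs.v *)
From mathcomp Require Import all_boot.

Set Implicit Arguments.
Unset Strict Implicit.
Unset Printing Implicit Defensive.

Notation cube n := {ffun 'I_n -> bool}.

Definition cube_adj n : rel (cube n) :=
  fun u v => #|[set j | u j != v j]| == 1.

(** Edges are unordered, i.e., two-element sets [[set u; v]] of vertices. *)
Definition dim_edge n (i : 'I_n) (e : {set cube n}) : bool :=
  [exists u, exists v, [&& e == [set u; v], cube_adj u v & u i != v i]].

(** A cyclic sequence h_0 ... h_(2^n - 1), with indices modulo 2^n: [ordS] is
    the cyclic successor on ['I_(2 ^ n)].  When n <= 1 this allows degenerate
    cycles, so it should only be used for n >= 2. *)
Definition hamiltonian_cycle n (h : 'I_(2 ^ n) -> cube n) : Prop :=
  bijective h /\ forall a, cube_adj (h a) (h (ordS a)).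

Definition cycle_edges n (h : 'I_(2 ^ n) -> cube n) : {set {set cube n}} :=
  [set [set h a; h (ordS a)] | a : 'I_(2 ^ n)].

Definition chromatic_vector n (h : 'I_(2 ^ n) -> cube n) : {ffun 'I_n -> nat} :=
  [ffun i => #|[set e in cycle_edges h | dim_edge i e]|].

Definition straight_in n (h : 'I_(2 ^ n) -> cube n) (v0 v1 v2 v3 : cube n) :=
  exists a b, [/\ h a = v0, h (ordS a) = v1, h b = v2 & h (ordS b) = v3].

Definition twisted_in n (h : 'I_(2 ^ n) -> cube n) (v0 v1 v2 v3 : cube n) :=
  exists a b, [/\ h a = v0, h (ordS a) = v1, h b = v3 & h (ordS b) = v2].

(** The rims of the square v0 v1 v2 v3 are the opposite edges {v0, v1} and
    {v2, v3}, both traversed by h. *)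
Definition inscribed_square n (h : 'I_(2 ^ n) -> cube n) (v0 v1 v2 v3 : cube n) :=
  ucycle (@cube_adj n) [:: v0; v1; v2; v3] /\
  (straight_in h v0 v1 v2 v3 \/ twisted_in h v0 v1 v2 v3).

(* Main.v *)
Require Import Defs.
From mathcomp Require Import all_boot.

(** Idea: identify an i-dimensional edge with its endpoint on the facet
    [u i = false].  The cycle marks more than half of the vertices of that
    facet, and for any other direction [j] the [j]-edges perfectly match the
    facet, so some [j]-edge has both ends marked: the two corresponding
    i-dimensional edges are opposite in a 4-cycle. *)

Definition flip {n : nat} (i : 'I_n) (u : cube n) : cube n :=
  [ffun k => (k == i) (+) u k].

Lemma flipK n (i : 'I_n) : involutive (flip i).
Proof. by move=> u; apply/ffunP=> k; rewrite !ffunE addKb. Qed.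

Lemma flipC n (i j : 'I_n) u : flip i (flip j u) = flip j (flip i u).
Proof. by apply/ffunP=> k; rewrite !ffunE addbCA. Qed.

Lemma cube_adj_flip n (i : 'I_n) u : cube_adj u (flip i u).
Proof.
apply/cards1P; exists i; apply/setP=> k; rewrite !inE !ffunE.
by case: (k == i) (u k) => [] [].
Qed.

Lemma cube_adj_sym n : symmetric (@cube_adj n).
Proof.
move=> u v; rewrite /cube_adj; congr (_ == _); apply: eq_card => k.
by rewrite !inE eq_sym.
Qed.

Lemma cube_adjP n (i : 'I_n) u v :
  cube_adj u v -> u i != v i -> v = flip i u.
Proof.
move=> /cards1P[l /setP diff_uv] uvi.
have il : i = l by apply/eqP; have := diff_uv i; rewrite !inE uvi => <-.
apply/ffunP=> k; have := diff_uv k; rewrite !inE ffunE -il => <-.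
by case: (u k) (v k) => [] [].
Qed.

Lemma dim_edge_flip n (i : 'I_n) u : dim_edge i [set u; flip i u].
Proof.
apply/existsP; exists u; apply/existsP; exists (flip i u).
by rewrite eqxx cube_adj_flip ffunE eqxx; case: (u i).
Qed.

(** The vertices are listed so that the first and third edges have dimension [i]: these are the rims
    of the square. *)
Lemma ucycle_flip n (i j : 'I_n) u : j != i ->
  ucycle (@cube_adj n) [:: u; flip i u; flip j (flip i u); flip j u].
Proof.
move=> ji; apply/andP; split.
  rewrite /= !cube_adj_flip /= -flipC cube_adj_sym cube_adj_flip.
  by rewrite cube_adj_sym cube_adj_flip.
have neq k (v w : cube n) : v k != w k -> v != w by apply: contraNneq => ->.
have ij : (i == j) = false by rewrite eq_sym (negPf ji).
rewrite /= !inE !negb_or !andbT -!andbA; apply/and5P; split.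
- by apply: (neq i); rewrite !ffunE eqxx; case: (u i).
- by apply: (neq i); rewrite !ffunE eqxx ij; case: (u i).
- by apply: (neq j); rewrite !ffunE eqxx; case: (u j).
- by apply: (neq j); rewrite !ffunE eqxx (negPf ji); case: (u j).
- by apply/andP; split=> //; apply: (neq i); rewrite !ffunE eqxx ij; case: (u i).
Qed.

Lemma double_card_disjoint_imset (T : finType) (f : T -> T) (A B : {set T}) :
    injective f -> [disjoint A & f @: A] -> A \subset B -> f @: A \subset B ->
  #|A|.*2 <= #|B|.
Proof.
move=> f_inj dAfA sAB sfAB; rewrite -addnn -{2}(card_imset _ f_inj).
(* Disjointness is the equality case of [leq_card_setU], so the sum becomes the size of a union
   inside [B]. *)
rewrite -[_ + _](eqP (_ : #|A :|: f @: A| == _)) ?(leq_card_setU _ _).2 //.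
by rewrite subset_leq_card // subUset sAB.
Qed.

(** [flip i] carries this facet to the opposite one, which is disjoint from it. *)
Lemma card_facet n (i : 'I_n) : #|[set u : cube n | ~~ u i]|.*2 <= 2 ^ n.
Proof.
have -> : 2 ^ n = #|[set: cube n]|.
  by rewrite cardsT card_ffun card_bool card_ord.
apply: double_card_disjoint_imset _ _ _ _ (inv_inj (flipK _ i)) _ _ _; rewrite ?subsetT //.
apply/pred0P=> u /=; apply/negbTE/negP; rewrite inE => /andP[ui /imsetP[v]].
by rewrite inE => vi uv; move: ui; rewrite uv ffunE eqxx addTb vi.
Qed.

Definition marked {n : nat} (h : 'I_(2 ^ n) -> cube n) (i : 'I_n) : {set cube n} :=
  [set u : cube n | ~~ u i & [set u; flip i u] \in cycle_edges h].

(** Every [i]-dimensional edge of the cycle is the image of a marked vertex under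
    [u |-> {u, flip i u}]. *)
Lemma chromatic_le_marked n (h : 'I_(2 ^ n) -> cube n) (i : 'I_n) :
  chromatic_vector h i <= #|marked h i|.
Proof.
rewrite ffunE; apply: leq_trans (leq_imset_card (fun u => [set u; flip i u]) _).
apply/subset_leq_card/subsetP=> e; rewrite inE => /andP[he].
case/existsP=> u /existsP[v /and3P[/eqP euv auv uvi]].
have vE := cube_adjP _ _ _ _ auv uvi; rewrite {}euv {}vE in he *.
(* The preimage is whichever endpoint has [i]-th coordinate false. *)
have [ui|ui] := boolP (u i); apply/imsetP; last by exists u; rewrite ?inE ?ui.
have swap : [set flip i u; flip i (flip i u)] = [set u; flip i u].
  by rewrite flipK setUC.
by exists (flip i u); rewrite ?inE ?swap // he ffunE eqxx ui.
Qed.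

(** Without such a pair, [flip j] moves the marked set off itself within the facet, so at most half
    of the facet is marked. *)
Lemma marked_pair n (h : 'I_(2 ^ n) -> cube n) (i j : 'I_n) :
    j != i -> 2 <= n -> 2 ^ (n - 2) < #|marked h i| ->
  exists2 u, u \in marked h i & flip j u \in marked h i.
Proof.
move=> ji n_ge2 many; apply/exists_inP; apply/contraLR: many => none.
(* Doubling twice, once for the facet in the cube and once for the marked set in the facet, avoids
   division; [2 <= n] makes the subtraction exact. *)
rewrite -leqNgt -leq_double -leq_double.
have -> : (2 ^ (n - 2)).*2.*2 = 2 ^ n.
  by rewrite -!mul2n -!expnS -(addn2 (n - 2)) subnK.
apply: leq_trans (card_facet n i); rewrite leq_double.
apply: double_card_disjoint_imset _ _ _ _ (inv_inj (flipK _ j)) _ _ _.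
- apply/pred0P=> u /=; apply/negbTE.
  apply: contra none => /andP[uM /imsetP[v vM uv]].
  by apply/exists_inP; exists v; rewrite -?uv.
- by apply/subsetP=> u; rewrite !inE => /andP[].
- apply/subsetP=> _ /imsetP[u uM ->]; move: uM.
  by rewrite !inE ffunE eq_sym (negPf ji) => /andP[].
Qed.

Lemma cycle_edgesP n (h : 'I_(2 ^ n) -> cube n) u v :
    [set u; v] \in cycle_edges h -> u != v ->
  exists a, (h a = u /\ h (ordS a) = v) \/ (h a = v /\ h (ordS a) = u).
Proof.
case/imsetP=> a _ /setP E uv; exists a.
(* Testing the set equality at [h a] tells which end comes first; testing it at the other end then
   identifies [h (ordS a)], as [u != v]. *)
have := E u; have := E v; rewrite !inE !eqxx orbT /=.
have := E (h a); rewrite !inE eqxx /=.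
case/orP=> /eqP ha /esym hv /esym hu; [left|right]; split=> //.
- by move: hv; rewrite ha eq_sym (negPf uv) => /eqP.
- by move: hu; rewrite ha (negPf uv) => /eqP.
Qed.

Theorem theorem3 (n : nat) (hn : 2 <= n) (h : 'I_(2 ^ n) -> cube n)
  (hamh : hamiltonian_cycle h) (i : 'I_n)
  (hc : 2 ^ (n - 2) < chromatic_vector h i) :
  exists v0 v1 v2 v3 : cube n,
    [/\ inscribed_square h v0 v1 v2 v3,
        dim_edge i [set v0; v1]
      & dim_edge i [set v2; v3]].
Proof.
have [j ji] : exists j : 'I_n, j != i.
  have /card_gt0P[j] : 0 < #|[set~ i]|.
    by rewrite cardsC1 card_ord -ltnS prednK // ltnW.
  by rewrite !inE; exists j.
have [u uM vM] := marked_pair n h i j ji hn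
  (leq_trans hc (chromatic_le_marked n h i)).
have flip_neq w : w != flip i w.
  apply: contraTneq (cube_adj_flip n i w) => <-.
  by apply/negP=> /cards1P[k /setP/(_ k)]; rewrite !inE !eqxx.
move: uM vM; rewrite !inE => /andP[_ ue] /andP[_ ve].
have [a hu] := cycle_edgesP n h _ _ ue (flip_neq u).
have [b hv] := cycle_edgesP n h _ _ ve (flip_neq _).
have dimC w : dim_edge i [set flip i w; w] by rewrite setUC dim_edge_flip.
(* The direction in which [h] runs through the first rim fixes [v0] and [v1]. The square is twisted
   if the second rim is run through in the same direction along [i], straight otherwise. *)
case: hu => -[ha ha'].
- exists u, (flip i u), (flip j (flip i u)), (flip j u).
  split; [split; first exact: ucycle_flip | exact: dim_edge_flip | by rewrite flipC].
  by case: hv => -[hb hb']; [right|left]; exists a, b; rewrite (flipC _ j i).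
- exists (flip i u), u, (flip j u), (flip j (flip i u)).
  split; [split | exact: dimC | by rewrite flipC dim_edge_flip].
    by have := ucycle_flip n i j (flip i u) ji; rewrite flipK.
  by case: hv => -[hb hb']; [left|right]; exists a, b; rewrite (flipC _ j i).
Qed.
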